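(* Let $C$ be a proper cone with nonempty interior $\operatorname{int}C$ in a real Banach space $(X,\|\cdot\|)$. Let $\psi\in C^*\setminus\{0\}$ and $\Sigma=\{x\in\operatorname{int}C\mid\psi(x)=1\}$. Let $G$ be a relatively open subset of $\Sigma$, and let $g:G\to\Sigma$ be a (norm-)continuous map that is nonexpansive with respect to Hilbert's projective metric $d$ (i.e. $d(g(x),g(y))\le d(x,y)$ for all $x,y\in G$). Assume that $v\in G$ is a fixed point of $g$. Assume: (A1) $g$ is semidifferentiable at $v$ with respect to $\psi^{-1}(0)$, with semidifferential $g'_v:\psi^{-1}(0)\to\psi^{-1}(0)$; (A2) there exist a relatively open neighborhood $U$ of $v$ in $\Sigma$, $U\subset G$, and a homogeneous generalized measure of noncompactness $\nu$ on $X$, such that $g|_U$ is a $k$-set contraction with $k<1$ with respect to $\nu$; (A3) the fixed point of $g'_v:\psi^{-1}(0)\to\psi^{-1}(0)$ is unique: if $x\in\psi^{-1}(0)$ and $x=g'_v(x)$, then $x=0$. Then $v$ is the only fixed point of $g$ in $G$: if $w\in G$ and $g(w)=w$, then $w=v$.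
   Context: Cones: a subset $C\subset X$ is a cone if $tC\subset C$ for all $t\ge0$. It is proper if it is closed, convex and pointed ($C\cap(-C)=\{0\}$); it then defines the partial order $x\le y\iff y-x\in C$. $C^*$ is the set of continuous linear forms $\psi$ on $X$ with $\psi(x)\ge0$ for all $x\in C$. Hilbert's projective metric: for $x,y\in\operatorname{int}C$, let $M(y/x)=\inf\{b\in\mathbb R\mid y\le bx\}$ and $m(y/x)=\sup\{a\in\mathbb R\mid ax\le y\}$; then $d(x,y)=\log M(y/x)-\log m(y/x)$. Semidifferentiability: a map $g:G\to Y$ ($G\subset X$, $v\in G$, $X,Y$ normed spaces) is semidifferentiable at $v$ with respect to a cone $K\subset X$ if $G$ contains a neighborhood of $v$ in $v+K$ and there is a continuous positively homogeneous map $h:K\to Y$ (i.e. $h(tx)=th(x)$ for $t>0$) such that $g(v+x)=g(v)+h(x)+o(\|x\|)$ as $x\to0$, $x\in K$. Such $h$ is unique and denoted $g'_v$. Measures of noncompactness: a homogeneous generalized measure of noncompactness on $X$ is a map $\nu$ from the bounded subsets of $X$ to $[0,\infty)$ such that for all bounded $A,B\subset X$ and real $\lambda$: $\nu(A)=0$ iff the closure of $A$ is compact; $\nu(A+B)\le\nu(A)+\nu(B)$; $\nu$ of the closed convex hull of $A$ equals $\nu(A)$; $\nu(\lambda A)=|\lambda|\nu(A)$; and $A\subset B$ implies $\nu(A)\le\nu(B)$. For a map $h:D\to X$, $D\subset X$, sending bounded sets to bounded sets, $\nu_D(h)=\inf\{\lambda>0\mid\nu(h(A))\le\lambda\nu(A)\text{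 for all bounded }A\subset D\}$; $h$ is a $k$-set contraction with respect to $\nu$ ($k<1$) if $\nu_D(h)\le k$. *)

(* Defs.v *)
From HB Require Import structures.
From mathcomp Require Import all_boot all_order all_algebra.
From mathcomp Require Import all_classical all_reals all_analysis.

Set Implicit Arguments.
Unset Strict Implicit.
Unset Printing Implicit Defensive.

Import Order.TTheory GRing.Theory Num.Theory.
Import numFieldNormedType.Exports.

Local Open Scope classical_set_scope.
Local Open Scope ring_scope.

Section Cones.
Context {R : realType} {X : normedModType R}.
Implicit Types C : set X.

Definition is_cone C := forall t x, 0 <= t -> C x -> C (t *: x).

Definition proper_cone C :=
  [/\ is_cone C, closed C, convex_set C & C `&` [set - x | x in C] = [set 0]].

Definition cone_le C (x y : X) := C (y - x).

Definition dual_cone C : set {linear X -> R^o} :=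
  [set psi : {linear X -> R^o} | continuous psi /\ forall x, C x -> 0 <= psi x].

(* [hilbert_M C y x] is M(y/x) and [hilbert_m C y x] is m(y/x). Since [inf],
   [sup] and [ln] are total real-valued functions with default values, these
   and [hilbert_dist] are meaningful only for x, y in the interior of a proper
   cone C of a nonzero space. *)
Definition hilbert_M C (y x : X) : R := inf [set b | cone_le C y (b *: x)].

Definition hilbert_m C (y x : X) : R := sup [set a | cone_le C (a *: x) y].

Definition hilbert_dist C (x y : X) : R :=
  ln (hilbert_M C y x) - ln (hilbert_m C y x).

Definition slice C (psi : X -> R) : set X :=
  C° `&` [set x | psi x = 1].

End Cones.

Definition relatively_open {T : topologicalType} (S A : set T) :=
  exists2 O, open O & A = S `&` O.

(* Maps defined on a subset of a space are represented by total functions whose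
   values outside that subset are never constrained: here only the restrictions
   g|_G and h|_K matter. *)
Definition is_semidifferential {R : realType} {X Y : normedModType R}
    (G : set X) (g : X -> Y) (v : X) (K : set X) (h : X -> Y) :=
  [/\ G v,
      \forall x \near (0 : X), K x -> G (v + x),
      {within K, continuous h},
      forall t x, 0 < t -> K x -> h (t *: x) = t *: h x
    & (fun x => g (v + x) - (g v + h x)) =o_ (within K (nbhs (0 : X))) id].

Section Noncompactness.
Context {R : realType} {X : normedModType R}.

Definition closed_convex_hull (A : set X) : set X :=
  smallest [set D | closed D /\ convex_set D] A.

(* The value of [nu] on unbounded sets is irrelevant. *)
Record homogeneous_noncompactness_measure (nu : set X -> R) : Prop := {
  ncm_ge0 : forall A, bounded_set A -> 0 <= nu A ;
  ncm_eq0 : forall A, bounded_set A -> nu A = 0 <-> compact (closure A) ;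
  ncm_add : forall A B, bounded_set A -> bounded_set B ->
    nu [set a + b | a in A & b in B] <= nu A + nu B ;
  ncm_hull : forall A, bounded_set A -> nu (closed_convex_hull A) = nu A ;
  ncm_scale : forall (l : R) A, bounded_set A ->
    nu [set l *: a | a in A] = `|l| * nu A ;
  ncm_mono : forall A B, bounded_set A -> bounded_set B -> A `<=` B ->
    nu A <= nu B }.

(* The infimum is taken in the extended reals, so that it is +oo when there is
   no admissible constant. *)
Definition noncompactness_constant (nu : set X -> R) (D : set X) (h : X -> X) :
    \bar R :=
  ereal_inf [set l%:E | l in [set l : R | 0 < l /\
    forall A, A `<=` D -> bounded_set A -> nu (h @` A) <= l * nu A]].

Definition set_contraction (nu : set X -> R) (D : set X) (h : X -> X) (k : R) :=
  [/\ forall A, A `<=` D -> bounded_set A -> bounded_set (h @` A),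
      k < 1
    & (noncompactness_constant nu D h <= k%:E)%E].

End Noncompactness.

(* Main.v *)
(* Let [F s y = (1 - t) g(y) + t (v + s (w - v))] with [0 < t < 1], where [w] is
   another fixed point of [g]. Each [F s] is a strict contraction for Hilbert's
   metric, [F 0] fixes [v], and [F 1] fixes [w]. By semidifferentiability, the
   set contraction property and uniqueness of the fixed point of [dg], the
   displacement satisfies [|g y - y| >= c |y - v|] near [v]; hence for small [t]
   no [F s] has a fixed point on a small sphere [|y - v| = r]. Starting from [v]
   and increasing [s] slowly while iterating [F s], one stays close, in Hilbert's
   metric, to a fixed point of [F s]; the cone need not be normal, so norm
   control comes from compactness instead: the visited points form a relatively
   compact set as long as they remain in the ball. A limit point is then either
   a fixed point of some [F s] on the sphere, which is excluded, or a fixed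
   point of [F 1] in the ball, which must be [w]. So [w] lies in the ball, and
   the displacement bound gives [w = v]. *)

Require Import Defs.
From HB Require Import structures.
From mathcomp Require Import all_boot all_order all_algebra.
From mathcomp Require Import all_classical all_reals all_analysis.
From mathcomp Require Import ring lra.

Set Implicit Arguments.
Unset Strict Implicit.
Unset Printing Implicit Defensive.

Import Order.TTheory GRing.Theory Num.Theory.
Import numFieldNormedType.Exports.

Local Open Scope classical_set_scope.
Local Open Scope ring_scope.

(** The existential keeps [L] opaque, so that an identity between vectors reduces to four identities
    between scalars; these suffice whether or not the vectors are independent. *)
Lemma linear_combinationsP (R : realType) (V : lmodType R) (x y z u : V) :
  exists L : R -> R -> R -> R -> V,
  [/\ forall a b c d a' b' c' d', L a b c d + L a' b' c' d' =
        L (a + a') (b + b') (c + c') (d + d'),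
      forall k a b c d, k *: L a b c d = L (k * a) (k * b) (k * c) (k * d),
      forall a b c d, - L a b c d = L (- a) (- b) (- c) (- d)
    & L 0 0 0 0 = 0] /\
  [/\ x = L 1 0 0 0, y = L 0 1 0 0, z = L 0 0 1 0 & u = L 0 0 0 1].
Proof.
exists (fun a b c d => a *: x + b *: y + c *: z + d *: u); split; split.
- move=> *; rewrite !scalerDl [LHS]addrACA; congr (_ + _).
  by rewrite [LHS]addrACA; congr (_ + _); rewrite addrACA.
- by move=> *; rewrite !scalerDr !scalerA.
- by move=> *; rewrite !scaleNr !opprD.
- by rewrite !scale0r !addr0.
- by rewrite scale1r !scale0r !addr0.
- by rewrite scale1r !scale0r !addr0 add0r.
- by rewrite scale1r !scale0r !addr0 !add0r.
- by rewrite scale1r !scale0r !add0r.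
Qed.

(* Proves an identity between linear combinations of the four given vectors by
   comparing coefficients. *)
Ltac module_eq x y z u :=
  let L := fresh "L" in let LD := fresh "LD" in let LZ := fresh "LZ" in
  let LN := fresh "LN" in let L0 := fresh "L0" in
  let Ex := fresh "Ex" in let Ey := fresh "Ey" in let Ez := fresh "Ez" in
  let Eu := fresh "Eu" in
  case: (linear_combinationsP x y z u) => L [[LD LZ LN L0] [Ex Ey Ez Eu]];
  rewrite ?Ex ?Ey ?Ez ?Eu -?L0 ?(LZ, LN, LD); congr (L _ _ _ _); field.

(** * The order defined by a proper cone and Hilbert's metric *)

(* For [x] and [y] in the slice, [cone_close C D y x] says that the Hilbert
   distance of [x] and [y] is at most [ln D]. *)
Definition cone_close (R : realType) (X : normedModType R) (C : set X)
    (D : R) (y x : X) :=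
  exists m M : R,
    [/\ 0 < m, cone_le C (m *: x) y, cone_le C y (M *: x) & M <= D * m].

Section ConeOrder.
Context {R : realType} {X : normedModType R} {C : set X}.
Context (C_proper : proper_cone C).

Lemma cone_scale (a : R) x : 0 <= a -> C x -> C (a *: x).
Proof. by move=> a0 Cx; case: C_proper => + _ _ _; apply. Qed.

Lemma cone_add (x y : X) : C x -> C y -> C (x + y).
Proof.
move=> Cx Cy; case: (C_proper) => _ _ cvx _.
have h0 : 0 <= (2^-1 : R) by lra.
have h1 : (2^-1 : R) <= 1 by lra.
have -> : x + y = 2 *: (2^-1 *: x + 2^-1 *: y).
  by rewrite scalerDr !scalerA divff // !scale1r.
apply: cone_scale => //.
have := cvx x y (Itv01 h0 h1) (mem_set Cx) (mem_set Cy).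
rewrite inE.
suff -> : conv (Itv01 h0 h1) (x : convex_lmodType X) y = 2^-1 *: x + 2^-1 *: y by [].
by congr (_ + _ *: _); rewrite /= /unstable.onem; field.
Qed.

Lemma cone_zero x : C x -> C 0.
Proof. by move=> Cx; rewrite -(scale0r x); apply: cone_scale. Qed.

Lemma cone_le_refl x z : C z -> cone_le C x x.
Proof. by rewrite /cone_le subrr; apply: cone_zero. Qed.

Lemma cone_le_trans y x z : cone_le C x y -> cone_le C y z -> cone_le C x z.
Proof.
rewrite /cone_le => xy yz.
by have -> : z - x = (y - x) + (z - y); [module_eq x y z x|apply: cone_add].
Qed.

Lemma cone_le_add x y x' y' :
  cone_le C x y -> cone_le C x' y' -> cone_le C (x + x') (y + y').
Proof.
rewrite /cone_le => xy xy'.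
have -> : y + y' - (x + x') = (y - x) + (y' - x') by module_eq x y x' y'.
exact: cone_add.
Qed.

Lemma cone_le_scale (a : R) x y :
  0 <= a -> cone_le C x y -> cone_le C (a *: x) (a *: y).
Proof. by move=> a0 xy; rewrite /cone_le -scalerBr; apply: cone_scale. Qed.

Lemma cone_le_scalel (a b : R) x :
  C x -> a <= b -> cone_le C (a *: x) (b *: x).
Proof.
by move=> Cx ab; rewrite /cone_le -scalerBl; apply: cone_scale => //; lra.
Qed.

Lemma cone_le_anti x y : cone_le C x y -> cone_le C y x -> x = y.
Proof.
move=> xy yx; case: C_proper => _ _ _ pt.
have : (C `&` [set - x | x in C]) (y - x).
  by split=> //; exists (x - y) => //; rewrite opprB.
by rewrite pt => /eqP; rewrite subr_eq0 => /eqP.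
Qed.

Lemma interior_absorbs x : C° x ->
  exists2 e : R, 0 < e & forall y : X, `|y| <= e -> cone_le C y x.
Proof.
move=> /nbhs_ballP[e /= e0 xC]; exists (e / 2) => [|y ye]; first lra.
apply: xC; rewrite -ball_normE /=.
by rewrite opprB addrC subrK; lra.
Qed.

(** [z] is the limit of [z + e *: u] as [e] tends to 0. This serves to show that the extremal
    constants of Hilbert's metric are attained. *)
Lemma cone_closed_ray (z u : X) : (forall e : R, 0 < e -> C (z + e *: u)) -> C z.
Proof.
move=> h; case: C_proper => _ /closure_id -> _ _ B /nbhs_ballP[r /= r0 rB].
have u0 : 0 <= `|u| by [].
have e0 : 0 < r / (`|u| + 1) by rewrite divr_gt0 //; lra.
exists (z + (r / (`|u| + 1)) *: u); split; first exact: h.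
apply: rB; rewrite -ball_normE /= opprD addrA subrr add0r normrN normrZ.
by rewrite gtr0_norm // mulrAC ltr_pdivrMr ?ltr_pM2l //; lra.
Qed.

Lemma interior_absorbs_point x y : C° x ->
  exists2 s : R, 0 < s & cone_le C y (s *: x).
Proof.
move=> /interior_absorbs[e e0 ex]; have y0 : 0 <= `|y| by [].
have [s s0 sy] : exists2 s : R, 0 < s & s^-1 * `|y| <= e.
  exists ((`|y| + 1) / e); first by rewrite divr_gt0 //; lra.
  by rewrite invf_div mulrAC ler_pdivrMr ?ler_pM2l //; lra.
exists s => //.
rewrite -[y in cone_le _ y]scale1r -(divff (lt0r_neq0 s0)) -scalerA.
apply: cone_le_scale; first exact: ltW.
by apply: ex; rewrite normrZ gtr0_norm ?invr_gt0.
Qed.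

Section Normalized.
Context {psi : {linear X -> R^o}}.
Context (psi_dual : dual_cone C psi).

Lemma cone_le_psi (a : R) x y :
  psi x = 1 -> psi y = 1 -> cone_le C (a *: x) y -> a <= 1.
Proof.
move=> x1 y1 axy; case: psi_dual => _ /(_ _ axy).
rewrite linearB linearZ/= x1 y1 => h.
have : 0 <= 1 - a * 1 by [].
lra.
Qed.

Lemma cone_ge_psi (b : R) x y :
  psi x = 1 -> psi y = 1 -> cone_le C y (b *: x) -> 1 <= b.
Proof.
move=> x1 y1 ybx; case: psi_dual => _ /(_ _ ybx).
rewrite linearB linearZ/= x1 y1 => h.
have : 0 <= b * 1 - 1 by [].
lra.
Qed.

(** Normalization by [psi] gives [m <= 1 <= M], so the ratio bound [M <= D * m] yields both [M <= D]
    and [m^-1 <= D]: a projective bound becomes an order bound. *)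
Lemma cone_close_bounds D x y : C x -> C y -> psi x = 1 -> psi y = 1 ->
  cone_close C D y x -> cone_le C y (D *: x) /\ cone_le C x (D *: y).
Proof.
move=> Cx Cy x1 y1 [m [M [m0 mx yM MD]]].
have m1 := cone_le_psi x1 y1 mx; have M1 := cone_ge_psi x1 y1 yM.
have D1 : M <= D by nra.
split.
  by apply: cone_le_trans yM _; apply: cone_le_scalel.
apply: (@cone_le_trans (m^-1 *: y)).
  rewrite -[x in cone_le _ x]scale1r -(mulVf (lt0r_neq0 m0)) -scalerA.
  by apply: cone_le_scale => //; rewrite invr_ge0 ltW.
apply: cone_le_scalel => //.
by rewrite -div1r ler_pdivrMr //; lra.
Qed.

Lemma cone_closeI D D' x y : 0 < D' ->
  cone_le C y (D *: x) -> cone_le C x (D' *: y) -> cone_close C (D * D') y x.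
Proof.
move=> D0 yx xy; exists D'^-1, D; split=> //; first by rewrite invr_gt0.
- rewrite -[y]scale1r -(mulVf (lt0r_neq0 D0)) -scalerA.
  by apply: cone_le_scale => //; rewrite invr_ge0 ltW.
- by rewrite mulfK // lt0r_neq0.
Qed.

(** The triangle inequality of Hilbert's metric in multiplicative form; normalization makes [M] and
    [M'] at least 1, so the ratio bounds can be multiplied. *)
Lemma cone_close_trans D D' x y z : psi x = 1 -> psi y = 1 -> psi z = 1 ->
  cone_close C D y x -> cone_close C D' z y -> cone_close C (D' * D) z x.
Proof.
move=> x1 y1 z1 [m [M [m0 mx yM MD]]] [m' [M' [m0' my zM MD']]].
have M1 := cone_ge_psi x1 y1 yM; have M1' := cone_ge_psi y1 z1 zM.
exists (m' * m), (M' * M); split.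
- exact: mulr_gt0.
- apply: cone_le_trans my; rewrite -scalerA.
  by apply: cone_le_scale => //; apply: ltW.
- apply: cone_le_trans zM _; rewrite -scalerA.
  by apply: cone_le_scale => //; lra.
- by rewrite mulrACA ler_pM //; lra.
Qed.

(* Since [M'/m' - 1 = th (M - m)/m'] for the affinely contracted bounds
   [M' = 1 + th (M - 1)] and [m' = 1 - th (1 - m)], it is [M/m - 1], rather than
   the Hilbert distance [ln (M/m)], that is contracted by the factor [th]. *)
Lemma cone_close_homotopy (t k D : R) (p x y : X) :
  0 < t < 1 -> 0 < k -> C x -> psi x = 1 -> psi y = 1 ->
  cone_le C (k *: x) p -> cone_close C D y x ->
  let th := (1 - t) / (1 - t + k * t) in
  cone_close C (1 + th * (D - 1)) ((1 - t) *: y + t *: p)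
    ((1 - t) *: x + t *: p).
Proof.
move=> /andP[t0 t1] k0 Cx x1 y1 kx [m [M [m0 mx yM MD]]] th.
have m1 := cone_le_psi x1 y1 mx; have M1 := cone_ge_psi x1 y1 yM.
have den0 : 0 < 1 - t + k * t by nra.
have thE : th * (1 - t + k * t) = 1 - t by rewrite /th divfK // lt0r_neq0.
have th0 : 0 < th by rewrite divr_gt0 //; lra.
have th1 : th < 1 by rewrite ltr_pdivrMr //; nra.
have tm0 : 0 <= t * th * (1 - m) by do 2?[apply: mulr_ge0]; lra.
have tM0 : 0 <= t * th * (M - 1) by do 2?[apply: mulr_ge0]; lra.
have t10 : 0 <= 1 - t by rewrite subr_ge0 ltW.
exists (1 - th * (1 - m)), (1 + th * (M - 1)); split.
- by nra.
- rewrite /cone_le.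
  (* Matching the coefficients of [x] amounts to [th * (1 - t + k * t) = 1 - t], which is the origin
     of [th]; the upper bound below leads to the same equation. *)
  have -> : (1 - t) *: y + t *: p -
      (1 - th * (1 - m)) *: ((1 - t) *: x + t *: p) =
    (1 - t) *: (y - m *: x) + (t * th * (1 - m)) *: (p - k *: x).
    by rewrite /th; module_eq x y p x; exact: lt0r_neq0.
  by apply: cone_add; apply: cone_scale.
- rewrite /cone_le.
  have -> : (1 + th * (M - 1)) *: ((1 - t) *: x + t *: p) -
      ((1 - t) *: y + t *: p) =
    (1 - t) *: (M *: x - y) + (t * th * (M - 1)) *: (p - k *: x).
    by rewrite /th; module_eq x y p x; exact: lt0r_neq0.
  by apply: cone_add; apply: cone_scale.
(* The right side minus the left side is [th * (D * m - M) + th * (1 - th) * (D - 1) * (1 - m)]. *)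
- have D1 : 1 <= D by nra.
  have h : 0 <= (D - 1) * (1 - m) by nra.
  have h2 : 0 <= th * (1 - th) by rewrite mulr_ge0 //; lra.
  have h3 : 0 <= th * (D * m - M) by rewrite mulr_ge0 //; lra.
  have h4 := mulr_ge0 h2 h.
  nra.
Qed.

(** Closedness of [C] makes the infimum and the supremum attained, so the extremal constants are
    themselves witnesses of closeness. *)
Lemma hilbert_dist_le_ln D x y : 0 < D -> slice C psi x -> slice C psi y ->
  hilbert_dist C x y <= ln D <-> cone_close C D y x.
Proof.
move=> D0 [xC /= x1] [yC /= y1].
have Cx : C x := interior_subset xC.
set P := [set b | cone_le C y (b *: x)].
set Q := [set a | cone_le C (a *: x) y].
have P0 : P !=set0 by have [s _ ys] := interior_absorbs_point y xC; exists s.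
have Plb : lbound P 1 by move=> b /(cone_ge_psi x1 y1).
have Qub : ubound Q 1 by move=> a /(cone_le_psi x1 y1).
(* A positive element of [Q] makes the supremum positive, so that [ln] is not evaluated at a default
   value. *)
have [s s0 xs] := interior_absorbs_point x yC.
have Qs : Q s^-1.
  rewrite /Q /= -[y]scale1r -(mulVf (lt0r_neq0 s0)) -scalerA.
  by apply: cone_le_scale => //; rewrite invr_ge0 ltW.
have hP : has_inf P by split=> //; exists 1.
have hQ : has_sup Q by split; [exists s^-1|exists 1].
have PM : P (hilbert_M C y x).
  apply: (@cone_closed_ray _ x) => e e0.
  have [b Pb bM] := inf_adherent e0 hP.
  rewrite addrAC -scalerDl; apply: cone_le_trans Pb _.
  by apply: cone_le_scalel => //; apply: ltW.
have Qm : Q (hilbert_m C y x).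
  apply: (@cone_closed_ray _ x) => e e0.
  have [a Qa am] := sup_adherent e0 hQ.
  rewrite -addrA -[- (_ *: x) + _]opprK opprD opprK -scalerBl.
  apply: cone_le_trans Qa.
  by apply: cone_le_scalel => //; apply: ltW.
have M1 : 1 <= hilbert_M C y x by apply: Plb.
have m0 : 0 < hilbert_m C y x.
  have : 0 < s^-1 by rewrite invr_gt0.
  by move=> /lt_le_trans; apply; apply: ub_le_sup => //; exists 1.
have M0 : 0 < hilbert_M C y x by lra.
rewrite /hilbert_dist lerBlDr -lnM // ler_ln ?posrE ?mulr_gt0 //.
split=> [MD|[m [M [m0' mx yM MD]]]].
  by exists (hilbert_m C y x), (hilbert_M C y x); split.
apply: (@le_trans _ _ M); first by apply: ge_inf => //; exists 1.
apply: le_trans MD _; rewrite ler_pM2l //.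
by apply: ub_le_sup => //; exists 1.
Qed.
End Normalized.
End ConeOrder.

(** * Measures of noncompactness *)

(** An ultrafilter finer than [\oo] replaces the extraction of subsequences: all sequences in
    compact sets converge along it simultaneously, and it decides every alternative between
    indices. *)
Lemma ultrafilter_oo : exists F : set_system nat, UltraFilter F /\ \oo `<=` F.
Proof. by have [F [FU ooF]] := @ultraFilterLemma nat \oo _; exists F. Qed.

Lemma ultrafilter_fmap (I T : Type) (F : set_system I) (u : I -> T) :
  UltraFilter F -> UltraFilter (u @ F).
Proof.
move=> FU; split=> [|G GP FG]; first exact: fmap_proper_filter.
apply/seteqP; split=> // A GA; rewrite /fmap /=.
have [//|FA] := in_ultra_setVsetC (u @^-1` A) FU.
have GC : G (~` A) by apply: FG.
exfalso; apply: (@filter_not_empty _ G _).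
by rewrite -(setICr A); apply: filterI.
Qed.

Lemma compact_ultra_cvg (T : topologicalType) (F : set_system nat) (K : set T)
    (u : nat -> T) : UltraFilter F -> compact K -> (forall n, K (u n)) ->
  exists2 l, K l & u @ F --> l.
Proof.
move=> FU; rewrite compact_ultra => cK Ku.
have FK : F (u @^-1` K) by apply: filterE => n; apply: Ku.
by have [l [Kl ul]] := cK _ (ultrafilter_fmap u FU) FK; exists l.
Qed.

Lemma within_continuous_cvg (T S : topologicalType) (D : set T) (f : T -> S)
    (F : set_system nat) (u : nat -> T) l : Filter F ->
  {within D, continuous f} -> (forall n, D (u n)) -> D l ->
  u @ F --> l -> (f \o u) @ F --> f l.
Proof.
move=> FF /subspace_continuousP fc Du Dl ul P fP.
have h : F (u @^-1` [set x | D x -> P (f x)]) by exact: ul (fc _ Dl _ fP).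
change (F ((f \o u) @^-1` P)).
by apply: (filterS _ h) => n /= ; apply.
Qed.

Section Noncompactness.
Context {R : realType} {X : normedModType R}.
Implicit Types A B K : set X.

Lemma bounded_setP A :
  bounded_set A <-> exists M : R, forall x, A x -> `|x| <= M.
Proof.
split=> [/pinfty_ex_gt0[M _ AM]|[M AM]]; first by exists M.
exists M; split; first exact: num_real.
by move=> N MN x /AM /le_trans; apply; apply: ltW.
Qed.

Lemma bounded_setS A B : A `<=` B -> bounded_set B -> bounded_set A.
Proof. by move=> AB /bounded_setP[M BM]; apply/bounded_setP; exists M => x /AB/BM. Qed.

Lemma bounded_set_add A B : bounded_set A -> bounded_set B ->
  bounded_set [set a + b | a in A & b in B].
Proof.
move=> /bounded_setP[M AM] /bounded_setP[N BN]; apply/bounded_setP.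
exists (M + N) => _ [a /AM aM [b /BN bN <-]].
by rewrite (le_trans (ler_normD _ _)) // lerD.
Qed.

Lemma bounded_set_scale (l : R) A : bounded_set A ->
  bounded_set [set l *: a | a in A].
Proof.
move=> /bounded_setP[M AM]; apply/bounded_setP.
by exists (`|l| * M) => _ [a /AM aM <-]; rewrite normrZ ler_wpM2l.
Qed.

Context {nu : set X -> R}.
Context (nu_ncm : homogeneous_noncompactness_measure nu).

Lemma ncm_compact K : compact K -> nu K = 0.
Proof.
move=> cK; apply/(ncm_eq0 nu_ncm); first exact: compact_bounded.
have := compact_closed (@norm_hausdorff _ X) cK.
by move=> /closure_id <-.
Qed.

Lemma ncm_le_add A B1 B2 : bounded_set B1 -> bounded_set B2 ->
  A `<=` [set a + b | a in B1 & b in B2] -> nu A <= nu B1 + nu B2.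
Proof.
move=> b1 b2 AB; have b12 := bounded_set_add b1 b2.
apply: le_trans (ncm_add nu_ncm b1 b2).
exact: (ncm_mono nu_ncm (bounded_setS AB b12) b12 AB).
Qed.

Lemma bounded_unit_ball : bounded_set [set x : X | `|x| <= 1].
Proof. by apply/bounded_setP; exists 1. Qed.

(** For every [e > 0] the range lies in a finite set plus [e] times the unit ball, so its measure is
    at most [e * nu B]. *)
Lemma ncm_cvg0 (z : nat -> X) : z @ \oo --> (0 : X) -> nu (range z) = 0.
Proof.
move=> z0; set B := [set x : X | `|x| <= 1].
have bB : bounded_set B by exact: bounded_unit_ball.
have nB := ncm_ge0 nu_ncm bB.
have key e : 0 < e -> bounded_set (range z) /\ nu (range z) <= e * nu B.
  move=> e0; have /cvgr0Pnorm_le/(_ _ e0)[m _ mz] := z0.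
  pose E := (z @` `I_m) `|` [set 0].
  have cE : compact E.
    apply: finite_compact; rewrite finite_setU; split=> //.
    by apply: finite_image; apply: finite_II.
  have bE : bounded_set E by exact: compact_bounded.
  have beB : bounded_set [set e *: b | b in B] by exact: bounded_set_scale.
  have sub : range z `<=` [set a + b | a in E & b in [set e *: b | b in B]].
    move=> _ [n _ <-]; have [nm|mn] := ltnP n m.
      exists (z n); first by left; exists n.
      exists 0; last by rewrite addr0.
      by exists 0; rewrite ?scaler0 //= /B /= normr0.
    exists 0; first by right.
    exists (z n); last by rewrite add0r.
    exists (e^-1 *: z n); last by rewrite scalerA divff ?scale1r ?gt_eqF.
    rewrite /B /= normrZ gtr0_norm ?invr_gt0 // mulrC ler_pdivrMr // mul1r.
    exact: mz.
  split; first by apply: bounded_setS sub _; apply: bounded_set_add.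
  apply: le_trans (ncm_le_add bE beB sub) _.
  by rewrite ncm_compact // add0r (ncm_scale nu_ncm) // gtr0_norm.
have [bz _] := key 1 ltr01.
apply/eqP; rewrite eq_le (ncm_ge0 nu_ncm bz) andbT.
apply/ler_addgt0Pr => e e0; rewrite add0r.
(* The [+ 1] covers the case [nu B = 0]. *)
have e1 : 0 < e / (nu B + 1) by rewrite divr_gt0 //; lra.
have [_ /le_trans] := key _ e1; apply.
by rewrite mulrAC ler_pdivrMr; nra.
Qed.

(** The infimum need not be known to be attained, so [k] itself may not be admissible; but as it is
    below 1, some admissible [l] is below 1 too. *)
Lemma set_contractionP U g k : set_contraction nu U g k ->
  exists2 l : R, 0 < l < 1 &
    forall A, A `<=` U -> bounded_set A ->
      bounded_set (g @` A) /\ nu (g @` A) <= l * nu A.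
Proof.
move=> [bg k1 gk].
have : (noncompactness_constant nu U g < 1%:E)%E.
  by apply: le_lt_trans gk _; rewrite lte_fin.
move=> /ereal_inf_lt[_ [l [l0 gl] <-]]; rewrite lte_fin => l1.
exists l; first by rewrite l0.
by move=> A AU bA; split; [apply: bg|apply: gl].
Qed.

End Noncompactness.

(** * Displacement near the fixed point *)

(* A set contraction has a set contraction as semidifferential; so if the
   displacements [x - dg x] of unit vectors came arbitrarily close to 0, these
   vectors would accumulate at a unit fixed point of [dg]. *)
Lemma semidifferential_unit_displacement (R : realType) (X : normedModType R)
    (nu : set X -> R) (l : R) (U G K : set X) (g dg : X -> X) (v : X) :
  homogeneous_noncompactness_measure nu -> 0 < l < 1 ->
  (forall A, A `<=` U -> bounded_set A ->
     bounded_set (g @` A) /\ nu (g @` A) <= l * nu A) ->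
  closed K -> (forall t x, 0 < t -> K x -> K (t *: x)) ->
  (\forall x \near (0 : X), K x -> U (v + x)) ->
  g v = v -> is_semidifferential G g v K dg ->
  (forall x, K x -> x = dg x -> x = 0) ->
  exists2 c : R, 0 < c & forall x, K x -> `|x| = 1 -> c <= `|x - dg x|.
Proof.
move=> nuP /andP[l0 l1] gU Kc Kt KU gv [_ _ dgc dgh /eqoP dgo] fix0.
apply: contrapT => noc.
have : forall n, exists x, [/\ K x, `|x| = 1 & `|x - dg x| <= harmonic n].
  move=> n; apply: contrapT => h; apply: noc.
  exists (harmonic n); first exact: harmonic_gt0.
  move=> x Kx x1; rewrite leNgt; apply/negP => /ltW xn.
  by apply: h; exists x; split.
move=> /choice[x xP].
have Kx n : K (x n) by case: (xP n).
have x1 n : `|x n| = 1 by case: (xP n).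
pose z n := x n - dg (x n).
have z0 : z @ \oo --> (0 : X).
  apply/cvgr0Pnorm_le => e e0.
  have /cvgr0Pnorm_le/(_ _ e0) := @cvg_harmonic R.
  apply: filterS => n; apply: le_trans; rewrite ger0_norm ?harmonic_ge0 //.
  by case: (xP n).
set A := range x; set B := [set x : X | `|x| <= 1].
have bB : bounded_set B by exact: bounded_unit_ball.
have bA : bounded_set A by apply/bounded_setP; exists 1 => _ [n _ <-]; rewrite x1.
have bz : bounded_set (range z).
  apply/bounded_setP; exists 1 => _ [n _ <-].
  case: (xP n) => _ _ /le_trans; apply.
  by rewrite /harmonic/= invf_le1 // ler1n.
have bdg : bounded_set (dg @` A).
  apply: bounded_setS (bounded_set_add bA (bounded_set_scale (-1) bz)).
  move=> _ [_ [n _ <-] <-]; exists (x n); first by exists n.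
  exists (-1 *: z n); first by exists (z n) => //; exists n.
  by rewrite scaleN1r /z opprB addrC subrK.
have nuA : nu A <= nu (dg @` A).
  have -> : nu (dg @` A) = nu (dg @` A) + nu (range z).
    by rewrite (ncm_cvg0 nuP z0) addr0.
  apply: ncm_le_add => // _ [n _ <-].
  exists (dg (x n)); first by exists (x n) => //; exists n.
  by exists (z n); [exists n|rewrite /z addrC subrK].
(* For small [s], homogeneity of [dg] and [g v = v] show that [dg (x n)] differs from
   [s^-1 *: (g (v + s *: x n) - v)] by at most [e] in norm; the contraction bound for [g] on
   [v + s A] is then rescaled. *)
have nudg e : 0 < e -> nu (dg @` A) <= l * nu A + e * nu B.
  move=> e0; have := dgo _ e0; rewrite near_withinE => /= dge.
  have : nbhs (0 : X) [set x | (K x -> U (v + x)) /\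
      (K x -> `|g (v + x) - (g v + dg x)| <= e * `|x|)] by exact: filterI.
  move=> /nbhs_ballP[r /= r0 rP].
  pose s := r / 2.
  have s0 : 0 < s by rewrite /s; lra.
  have rx n : ball (0 : X) r (s *: x n).
    rewrite -ball_normE /= sub0r normrN normrZ x1 gtr0_norm //.
    by rewrite /s; lra.
  have Ksx n : K (s *: x n) by apply: Kt.
  have bsA := bounded_set_scale s bA.
  pose V := [set v + a | a in [set s *: a | a in A]].
  have VE : V `<=` [set a + b | a in [set v] & b in [set s *: a | a in A]].
    by move=> _ [a ? <-]; exists v => //; exists a.
  have bv (w : X) : bounded_set [set w].
    by apply/bounded_setP; exists `|w| => _ ->.
  have bV : bounded_set V by apply: bounded_setS VE _; exact: bounded_set_add.
  have VU : V `<=` U.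
    by move=> _ [_ [_ [n _ <-] <-] <-]; case: (rP _ (rx n)) => + _; apply.
  have [bgV gV] := gU _ VU bV.
  have nuV : nu V <= s * nu A.
    apply: le_trans (ncm_le_add nuP (bv v) bsA VE) _.
    by rewrite ncm_compact ?add0r ?(ncm_scale nuP) ?gtr0_norm //; exact: compact_set1.
  pose W := [set a + b | a in [set s^-1 *: a | a in g @` V]
                       & b in [set - (s^-1 *: v)]].
  have bsg := bounded_set_scale s^-1 bgV.
  have bW : bounded_set W by exact: bounded_set_add.
  have nuW : nu W <= l * nu A.
    apply: le_trans (ncm_add nuP bsg (bv _)) _.
    rewrite [nu [set _]](ncm_compact nuP) ?addr0; last exact: compact_set1.
    rewrite (ncm_scale nuP) // gtr0_norm ?invr_gt0 //.
    rewrite mulrC ler_pdivrMr //; apply: le_trans gV _.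
    by rewrite -mulrA [_ * s]mulrC ler_pM2l.
  have beB := bounded_set_scale e bB.
  have sub : dg @` A `<=` [set a + b | a in W & b in [set e *: b | b in B]].
    move=> _ [_ [n _ <-] <-].
    exists (s^-1 *: g (v + s *: x n) - s^-1 *: v).
      exists (s^-1 *: g (v + s *: x n)); last by exists (- (s^-1 *: v)).
      exists (g (v + s *: x n)) => //; exists (v + s *: x n) => //.
      by exists (s *: x n) => //; exists (x n) => //; exists n.
    pose w := g (v + s *: x n) - (g v + dg (s *: x n)).
    have we : `|w| <= e * s.
      case: (rP _ (rx n)) => _ /(_ (Ksx n)).
      by rewrite normrZ x1 mulr1 gtr0_norm.
    exists (e *: (- (e^-1 * s^-1) *: w)).
      exists (- (e^-1 * s^-1) *: w) => //.
      rewrite /B /= normrZ normrN gtr0_norm ?mulr_gt0 ?invr_gt0 //.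
      by rewrite -invfM mulrC ler_pdivrMr ?mulr_gt0 // mul1r.
    rewrite /w gv dgh //.
    by module_eq (g (v + s *: x n)) v (dg (x n)) v; rewrite ?gt_eqF.
  apply: le_trans (ncm_le_add nuP bW beB sub) _.
  by apply: lerD => //; rewrite (ncm_scale nuP) // gtr0_norm.
have nuA0 : nu A = 0.
  have nA := ncm_ge0 nuP bA; have nB := ncm_ge0 nuP bB.
  apply/eqP; rewrite eq_le nA andbT.
  have : (1 - l) * nu A <= 0.
    apply/ler_addgt0Pr => e e0; rewrite add0r.
    have e1 : 0 < e / (nu B + 1) by rewrite divr_gt0 //; lra.
    have := le_trans nuA (nudg _ e1).
    have : e / (nu B + 1) * nu B <= e.
      by rewrite mulrAC ler_pdivrMr; nra.
    lra.
  by rewrite pmulr_rle0 // subr_gt0.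
(* The limit [p] of the [x n] along an ultrafilter has norm 1 and, since [z] tends to 0, is fixed by
   [dg]. *)
have cA : compact (closure A) by apply/(ncm_eq0 nuP).
have [F [FU ooF]] := ultrafilter_oo.
have Ax n : closure A (x n) by apply: subset_closure; exists n.
have [p _ xp] := compact_ultra_cvg FU cA Ax.
have Kp : K p by apply: (closed_cvg K Kc _ p xp); exact: filterE.
have p1 : `|p| = 1.
  have np : (fun n => `|x n|) @ F --> `|p| by exact: cvg_norm.
  rewrite (_ : (fun n => `|x n|) = cst 1) in np; last exact/funext.
  by apply: (norm_cvg_unique np); exact: cvg_cst.
have dgp : (dg \o x) @ F --> dg p by exact: within_continuous_cvg xp.
have zp : z @ F --> p - dg p by exact: cvgB.
have zF : z @ F --> (0 : X) by move=> P /z0; exact: ooF.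
have pE : p = dg p.
  apply/eqP; rewrite -subr_eq0; apply/eqP.
  exact: norm_cvg_unique zp zF.
by move: p1; rewrite (fix0 p Kp pE) normr0 => /eqP; rewrite eq_sym oner_eq0.
Qed.

(** Homogeneity turns the bound on unit vectors into [c * |x| <= |x - dg x|]; near 0 the remainder
    of the semidifferential costs at most half of it. *)
Lemma semidifferential_displacement (R : realType) (X : normedModType R)
    (nu : set X -> R) (l : R) (U G K : set X) (g dg : X -> X) (v : X) :
  homogeneous_noncompactness_measure nu -> 0 < l < 1 ->
  (forall A, A `<=` U -> bounded_set A ->
     bounded_set (g @` A) /\ nu (g @` A) <= l * nu A) ->
  closed K -> (forall t x, 0 < t -> K x -> K (t *: x)) ->
  (\forall x \near (0 : X), K x -> U (v + x)) ->
  g v = v -> is_semidifferential G g v K dg ->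
  (forall x, K x -> x = dg x -> x = 0) ->
  exists2 c : R, 0 < c &
    \forall x \near (0 : X), K x -> c * `|x| <= `|g (v + x) - (v + x)|.
Proof.
move=> nuP l01 gU Kc Kt KU gv dgP fix0.
have [c c0 cP] :=
  semidifferential_unit_displacement nuP l01 gU Kc Kt KU gv dgP fix0.
case: dgP => _ _ _ dgh /eqoP dgo.
exists (c / 2); first by rewrite divr_gt0.
have c2 : 0 < c / 2 by rewrite divr_gt0.
have := dgo _ c2; rewrite near_withinE /=; apply: filterS => x xP Kx.
have [->|x0] := eqVneq x 0; first by rewrite normr0 mulr0.
have nx0 : 0 < `|x| by rewrite normr_gt0.
pose u := `|x|^-1 *: x.
have Ku : K u by apply: Kt; rewrite ?invr_gt0.
have u1 : `|u| = 1 by rewrite normrZ normfV normr_id mulVf // gt_eqF.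
have xE : x = `|x| *: u by rewrite scalerA divff ?gt_eqF // scale1r.
have dgx : `|x - dg x| = `|x| * `|u - dg u|.
  by rewrite {1 2}xE dgh // -scalerBr normrZ normr_id.
have h1 : c * `|x| <= `|x - dg x|.
  by rewrite dgx mulrC ler_pM2l //; apply: cP.
have := xP Kx; set w := _ - _ => h2.
have : `|x - dg x| <= `|g (v + x) - (v + x)| + `|w|.
  rewrite -[`|g _ - _|]normrN; apply: le_trans (ler_normD _ _).
  rewrite (_ : - (g (v + x) - (v + x)) + w = x - dg x) // /w gv.
  by module_eq (g (v + x)) (dg x) v x.
lra.
Qed.

(** * Continuation along the homotopy *)

Definition homotopy (R : realType) (X : normedModType R) (g : X -> X)
    (v w : X) (t s : R) (y : X) : X :=
  (1 - t) *: g y + t *: (v + s *: (w - v)).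

(** The parameter is free in [0, 1] at each step, so that a single set, with a single compactness
    statement, contains the trajectories for all step sizes. *)
Inductive reachable (R : realType) (X : normedModType R) (F : R -> X -> X)
    (B : set X) (v : X) : X -> Prop :=
| reachable_start : reachable F B v v
| reachable_step s y : reachable F B v y -> 0 <= s <= 1 -> B (F s y) ->
    reachable F B v (F s y).

Lemma reachable_sub (R : realType) (X : normedModType R) (F : R -> X -> X)
    (B : set X) (v : X) : B v -> reachable F B v `<=` B.
Proof. by move=> Bv _ [|]. Qed.

(* The set [A] of reachable points satisfies [A c (1 - t) g(A) + t [v, w]],
   whence [nu A <= (1 - t) l nu A]. *)
Lemma compact_closure_reachable (R : realType) (X : normedModType R)
    (nu : set X -> R) (l t : R) (B : set X) (g : X -> X) (v w : X) :
  homogeneous_noncompactness_measure nu -> 0 < l < 1 -> 0 < t < 1 ->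
  (forall A, A `<=` B -> bounded_set A ->
     bounded_set (g @` A) /\ nu (g @` A) <= l * nu A) ->
  bounded_set B -> B v -> g v = v ->
  compact (closure (reachable (homotopy g v w t) B v)).
Proof.
move=> nuP /andP[l0 l1] /andP[t0 t1] gB bB Bv gv.
set A := reachable _ _ _.
have AB : A `<=` B by exact: reachable_sub.
have bA : bounded_set A by exact: bounded_setS AB bB.
have [bgA gA] := gB _ AB bA.
pose S := (fun s : R => t *: (v + s *: (w - v))) @` [set` `[0, 1]].
have cS : compact S.
  apply: continuous_compact; last exact: segment_compact.
  apply: continuous_subspaceT => s.
  apply: cvgZ; first exact: cvg_cst.
  by apply: cvgD; [exact: cvg_cst|apply: cvgZ; [exact: cvg_id|exact: cvg_cst]].
have bS := compact_bounded cS.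
have bsg := bounded_set_scale (1 - t) bgA.
have sub : A `<=` [set a + b | a in [set (1 - t) *: a | a in g @` A] & b in S].
  move=> _ [|s y Ay s01 _].
    exists ((1 - t) *: v).
      by exists v => //; exists v => //; exact: reachable_start.
    exists (t *: v); last by module_eq v v v v.
    by exists 0; rewrite ?scale0r ?addr0 //= in_itv/= lexx ler01.
  exists ((1 - t) *: g y); first by exists (g y) => //; exists y.
  by exists (t *: (v + s *: (w - v))) => //; exists s => //=; rewrite in_itv.
have := ncm_le_add nuP bsg bS sub.
rewrite (ncm_compact nuP cS) addr0 (ncm_scale nuP) // gtr0_norm ?subr_gt0 //.
move=> nuA; apply/(ncm_eq0 nuP) => //.
have nA := ncm_ge0 nuP bA; apply/eqP; rewrite eq_le nA andbT.
have : (1 - t) * nu (g @` A) <= nu (g @` A).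
  by have := ncm_ge0 nuP bgA; nra.
have : (1 - l) * nu A <= 0 -> nu A <= 0 by rewrite pmulr_rle0 // subr_gt0.
nra.
Qed.

Section Tracking.
Context {R : realType} {X : normedModType R} {C : set X}.
Context (C_proper : proper_cone C).
Context {psi : {linear X -> R^o}}.
Context (psi_dual : dual_cone C psi).

Lemma cone_close_le D D' x y :
  D <= D' -> cone_close C D y x -> cone_close C D' y x.
Proof.
move=> DD' [m [M [m0 mx yM MD]]]; exists m, M; split=> //.
by apply: le_trans MD _; rewrite ler_pM2r.
Qed.

Lemma psi_segment v w s : psi v = 1 -> psi w = 1 -> psi (v + s *: (w - v)) = 1.
Proof.
by move=> v1 w1; rewrite linearD linearZ linearB/= v1 w1 subrr scaler0 addr0.
Qed.

Lemma psi_homotopy g v w t s y : psi v = 1 -> psi w = 1 -> psi (g y) = 1 ->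
  psi (homotopy g v w t s y) = 1.
Proof.
move=> v1 w1 y1.
rewrite /homotopy linearD !linearZ/= psi_segment // y1 -scalerDl subrK.
exact: scale1r.
Qed.

Lemma cone_le_segment k q v w s : 0 <= s <= 1 ->
  cone_le C (k *: q) v -> cone_le C (k *: q) w ->
  cone_le C (k *: q) (v + s *: (w - v)).
Proof.
move=> /andP[s0 s1]; rewrite /cone_le => qv qw.
have -> : v + s *: (w - v) - k *: q =
    (1 - s) *: (v - k *: q) + s *: (w - k *: q) by module_eq v w q q.
by apply: cone_add => //; apply: cone_scale => //; rewrite subr_ge0.
Qed.

(* Moving the parameter [s] by [h] perturbs the map by a factor [1 + h * K],
   because [w - v] is dominated by the segment from [v] to [w]. *)
Lemma cone_le_homotopy (g : X -> X) (v w y : X) (t s h K : R) :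
  0 < t < 1 -> 0 <= s <= 1 -> C (g y) -> 0 <= K ->
  cone_le C (w - v) (K *: v) -> cone_le C (w - v) (K *: w) ->
  cone_le C (v - w) (K *: v) -> cone_le C (v - w) (K *: w) ->
  cone_le C (homotopy g v w t (s + h) y)
    ((1 + `|h| * K) *: homotopy g v w t s y).
Proof.
move=> /andP[t0 t1] s01 Cy K0 wv ww vv vw.
have [s0 s1] := andP s01.
pose p := v + s *: (w - v).
have pE : p = (1 - s) *: v + s *: w by rewrite /p; module_eq v w v v.
have ppos : cone_le C (w - v) (K *: p).
  have -> : w - v = (1 - s) *: (w - v) + s *: (w - v) by module_eq v w v v.
  have -> : K *: p = (1 - s) *: (K *: v) + s *: (K *: w).
    by rewrite pE; module_eq v w v v.
  by apply: cone_le_add => //; apply: cone_le_scale => //; rewrite subr_ge0.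
have pneg : cone_le C (v - w) (K *: p).
  have -> : v - w = (1 - s) *: (v - w) + s *: (v - w) by module_eq v w v v.
  have -> : K *: p = (1 - s) *: (K *: v) + s *: (K *: w).
    by rewrite pE; module_eq v w v v.
  by apply: cone_le_add => //; apply: cone_le_scale => //; rewrite subr_ge0.
(* The sign of [h] decides which of [ppos] and [pneg] applies. *)
have hp : cone_le C (h *: (w - v)) (`|h| *: (K *: p)).
  have [h0|h0] := lerP 0 h.
    by rewrite ger0_norm //; apply: cone_le_scale.
  rewrite ltr0_norm // -[h *: _]opprK -scaleNr -scalerN opprB.
  by apply: cone_le_scale => //; rewrite oppr_ge0 ltW.
have hK : 0 <= `|h| * K by rewrite mulr_ge0.
have -> : homotopy g v w t (s + h) y =
    ((1 - t) *: g y + t *: p) + t *: (h *: (w - v)).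
  by rewrite /homotopy /p; module_eq (g y) v w v.
have -> : (1 + `|h| * K) *: homotopy g v w t s y =
    ((1 - t) *: g y + t *: p) +
    ((`|h| * K * (1 - t)) *: g y + t *: (`|h| *: (K *: p))).
  by rewrite /homotopy -/p; module_eq (g y) p p p.
have gy0 := cone_le_refl C_proper ((1 - t) *: g y + t *: p) Cy.
apply: cone_le_add => //.
rewrite -[t *: (h *: _)]add0r; apply: cone_le_add => //.
  rewrite /cone_le subr0; apply: cone_scale => //.
  by rewrite mulr_ge0 // subr_ge0 ltW.
by apply: cone_le_scale => //; apply: ltW.
Qed.

(* Along [y_(j+1) = F (j/N) y_j], the bound [1 + e] between [F (j/N) y_j] and
   [y_j] is contracted to [1 + th e] by the map, and the change of parameter
   costs a factor [(1 + K/N)^2]; for [N] large the bound is restored. *)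
Lemma homotopy_tracking (g : X -> X) (B : set X) (v w : X) (t k K e : R) :
  0 < t < 1 -> 0 < k -> 0 <= K -> 0 < e <= 1 -> psi v = 1 -> psi w = 1 ->
  (forall y, B y -> [/\ C (g y), psi y = 1, psi (g y) = 1,
     cone_le C (k *: g y) v & cone_le C (k *: g y) w]) ->
  (forall D x y, B x -> B y -> cone_close C D y x ->
     cone_close C D (g y) (g x)) ->
  cone_le C (w - v) (K *: v) -> cone_le C (w - v) (K *: w) ->
  cone_le C (v - w) (K *: v) -> cone_le C (v - w) (K *: w) ->
  B v -> g v = v -> let F := homotopy g v w t in
  exists z s, [/\ reachable F B v z, 0 <= s <= 1,
     cone_close C (1 + e) (F s z) z & s = 1 \/ ~ B (F s z)].
Proof.
move=> t01 k0 K0 /andP[e0 e1] v1 w1 Bg gD wv ww vv vw Bv gv F.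
have [t0 t1] := andP t01.
set th := (1 - t) / (1 - t + k * t).
have den0 : 0 < 1 - t + k * t by nra.
have th0 : 0 < th by rewrite divr_gt0 //; lra.
have th1 : th < 1 by rewrite ltr_pdivrMr //; nra.
(* Since [d <= 1] and [th * e <= 1], [(1 + d)^2 * (1 + th * e) <= (1 + 3 * d) * (1 + th * e) <= 1 +
   th * e + 6 * d = 1 + e]. *)
pose d := (1 - th) * e / 6.
have d0 : 0 < d by rewrite /d divr_gt0 // mulr_gt0 // subr_gt0.
have d1 : d <= 1 by rewrite /d; nra.
have [N N0 KN] : exists2 N : nat, (0 < N)%N & K <= d * N%:R.
  have K1 : 0 <= K / d by rewrite divr_ge0 // ltW.
  exists (Num.bound (K / d)).+1 => //.
  have := archi_boundP K1; rewrite ltr_pdivrMr // -natr1.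
  nra.
have N0R : 0 < N%:R :> R by rewrite ltr0n.
(* If no such pair exists, the trajectory never leaves [B], so it can be continued up to the
   parameter 1, which is itself excluded. *)
apply: contrapT => none.
have track j : (j <= N)%N -> exists2 y, reachable F B v y &
    cone_close C (1 + e) (F (j%:R / N%:R) y) y.
  elim: j => [_|j IH jN].
    exists v; first exact: reachable_start.
    have -> : F (0%:R / N%:R) v = v.
      by rewrite /F /homotopy gv mul0r; module_eq v w v v.
    have Cv : C v by case: (Bg v Bv); rewrite gv.
    have vv1 := cone_le_refl C_proper v Cv.
    by exists 1, 1; rewrite scale1r; split=> //; lra.
  have [y yR yF] := IH (ltnW jN).
  set s := j%:R / N%:R in yF.
  have s01 : 0 <= s <= 1.
    by rewrite divr_ge0 ?ler0n //= ler_pdivrMr // mul1r ler_nat ltnW.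
  have BF : B (F s y).
    by apply: contrapT => nB; apply: none; exists y, s; split=> //; right.
  exists (F s y); first exact: reachable_step.
  have By := reachable_sub Bv yR.
  have [Cgy y1 gy1 kyv kyw] := Bg _ By.
  have [CgF F1 gF1 kFv kFw] := Bg _ BF.
  pose h : R := N%:R^-1.
  have s'E : j.+1%:R / N%:R = s + h by rewrite /s /h -natr1 mulrDl mul1r.
  rewrite s'E.
  have s'01 : 0 <= s + h <= 1.
    by rewrite -s'E divr_ge0 ?ler0n //= ler_pdivrMr // mul1r ler_nat.
  have h0 : 0 < h by rewrite invr_gt0.
  have hK : `|h| * K <= d.
    by rewrite gtr0_norm // /h mulrC ler_pdivrMr.
  have hK0 : 0 <= `|h| * K by rewrite mulr_ge0.
  have step1 : cone_close C (1 + th * (1 + e - 1)) (F s (F s y)) (F s y).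
    apply: (cone_close_homotopy C_proper psi_dual) => //; last exact: gD.
    exact: cone_le_segment.
  have step2 : cone_close C ((1 + `|h| * K) * (1 + `|h| * K))
      (F (s + h) (F s y)) (F s (F s y)).
    apply: (cone_closeI C_proper); first by lra.
      exact: cone_le_homotopy.
    have -> : F s (F s y) = F (s + h + - h) (F s y) by rewrite addrK.
    by rewrite -[`|h|]normrN; apply: cone_le_homotopy.
  have FF1 r : psi (F r (F s y)) = 1 by exact: psi_homotopy.
  apply: cone_close_le
    (cone_close_trans C_proper psi_dual F1 (FF1 _) (FF1 _) step1 step2).
  have E1 : (1 + `|h| * K) * (1 + `|h| * K) <= 1 + 3 * d by nra.
  have E2 : 0 <= th * e <= 1 by nra.
  have E3 : 6 * d = (1 - th) * e by rewrite /d; field.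
  apply: (@le_trans _ _ ((1 + 3 * d) * (1 + th * e))).
    by apply: ler_pM => //; nra.
  nra.
have [y yR yF] := track N (leqnn N).
apply: none; exists y, 1; rewrite divff ?gt_eqF // in yF.
by split=> //; [rewrite ler01 lexx|left].
Qed.
End Tracking.

(** In the limit along an ultrafilter, closeness with constants tending to 1 gives [F q p <= p] and
    [p <= F q p] for the order of [C], hence equality by antisymmetry. *)
Lemma homotopy_limit (R : realType) (X : normedModType R) (C : set X)
    (psi : {linear X -> R^o}) (g : X -> X) (v w : X) (t r : R) :
  let B := [set y | psi y = 1 /\ `|y - v| <= r] in
  let F := homotopy g v w t in
  proper_cone C -> dual_cone C psi -> psi w = 1 ->
  B v -> (forall y, B y -> C y /\ C (g y) /\ psi (g y) = 1) ->
  (forall s y, 0 <= s <= 1 -> B y -> C (F s y)) ->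
  {within B, continuous g} -> compact (closure (reachable F B v)) ->
  (forall n : nat, exists z s, [/\ reachable F B v z, 0 <= s <= 1,
     cone_close C (1 + harmonic n) (F s z) z & s = 1 \/ ~ B (F s z)]) ->
  exists z s, [/\ B z, 0 <= s <= 1, F s z = z & s = 1 \/ r <= `|z - v|].
Proof.
move=> B F C_proper psi_dual w1 Bv Bg CF gc cA h.
have /choice[z /choice[s zsP]] := h.
have v1 : psi v = 1 by case: Bv.
have psic : continuous (psi : X -> R^o) by case: psi_dual.
have Bz n : B (z n) by case: (zsP n) => /(reachable_sub Bv).
have Fz1 n : psi (F (s n) (z n)) = 1.
  by apply: psi_homotopy => //; case: (Bg _ (Bz n)) => _ [].
have s01 n : `[0, 1]%classic (s n) by rewrite /= in_itv/=; case: (zsP n).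
have Cc : closed C by case: C_proper.
have [F0 [FU ooF]] := ultrafilter_oo.
have Az n : closure (reachable F B v) (z n).
  by apply: subset_closure; case: (zsP n).
have [p _ zp] := compact_ultra_cvg FU cA Az.
have [q q01 sq] := compact_ultra_cvg FU (@segment_compact R 0 1) s01.
have e0 : (fun n => 1 + harmonic n : R) @ F0 --> (1 : R).
  rewrite -[X in _ --> X]addr0; apply: cvgD; first exact: cvg_cst.
  by move=> P /cvg_harmonic; exact: ooF.
have pv : (fun n => `|z n - v|) @ F0 --> `|p - v|.
  by apply: cvg_norm; apply: cvgB => //; exact: cvg_cst.
have Bp : B p.
  split.
    have : (fun n => psi (z n) : R) @ F0 --> (psi p : R).
      exact: (continuous_cvg _ (psic p) zp).
    rewrite (_ : (fun n => _) = cst 1); last by apply/funext => n; case: (Bz n).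
    by move=> /norm_cvg_unique -/(_ _ (cvg_cst _)).
  apply: (closed_cvg (fun x => x <= r) (@closed_le _ r) _ _ pv).
  by apply: filterE => n; case: (Bz n).
have gp : (g \o z) @ F0 --> g p by exact: within_continuous_cvg zp.
have Fp : (fun n => F (s n) (z n)) @ F0 --> F q p.
  apply: cvgD; first by apply: cvgZ => //; exact: cvg_cst.
  apply: cvgZ; first exact: cvg_cst.
  apply: cvgD; first exact: cvg_cst.
  by apply: cvgZ => //; exact: cvg_cst.
have bounds n : cone_le C (F (s n) (z n)) ((1 + harmonic n) *: z n) /\
    cone_le C (z n) ((1 + harmonic n) *: F (s n) (z n)).
  case: (zsP n) => _ sn clo _; case: (Bg _ (Bz n)) => Cz _.
  apply: (cone_close_bounds C_proper psi_dual) => //; first exact: CF.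
  by case: (Bz n).
have FE : F q p = p.
  apply: (cone_le_anti C_proper).
    have : (fun n => (1 + harmonic n) *: z n - F (s n) (z n)) @ F0 -->
        1 *: p - F q p by exact: (cvgB (cvgZ e0 zp) Fp).
    rewrite scale1r; apply: (closed_cvg C Cc).
    by apply: filterE => n; case: (bounds n).
  have : (fun n => (1 + harmonic n) *: F (s n) (z n) - z n) @ F0 -->
      1 *: F q p - p by exact: (cvgB (cvgZ e0 Fp) zp).
  rewrite scale1r; apply: (closed_cvg C Cc).
  by apply: filterE => n; case: (bounds n).
exists p, q; split=> //.
have [s1|s1] := in_ultra_setVsetC [set n | s n = 1] FU.
  left; have c1 : closed [set x : R | x = 1] by exact: closed_eq.
  exact: (closed_cvg _ c1 s1 q sq).
(* It is [F (s n) (z n)], not [z n], that lies outside the ball; both have the limit [p = F q p]. *)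
right; rewrite -FE.
have Fv : (fun n => `|F (s n) (z n) - v|) @ F0 --> `|F q p - v|.
  by apply: cvg_norm; apply: cvgB => //; exact: cvg_cst.
apply: (closed_cvg (fun x => r <= x) (@closed_ge _ r) _ _ Fv).
apply: filterS s1 => n /= sn; case: (zsP n) => _ _ _ [//|nB].
by rewrite leNgt; apply/negP => Fr; apply: nB; split=> //; apply: ltW.
Qed.

(** Both [z] and [w] are fixed by the homotopy at parameter 1, so their constant [D = exp d(z, w)]
    satisfies [D - 1 <= th * (D - 1)] with [th < 1], which forces [D = 1]. *)
Lemma hilbert_fixed_points_eq (R : realType) (X : normedModType R) (C : set X)
    (psi : {linear X -> R^o}) (G : set X) (g : X -> X) (t k : R) (z w : X) :
  proper_cone C -> dual_cone C psi -> G `<=` slice C psi ->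
  set_fun G (slice C psi) g ->
  (forall x y, G x -> G y ->
     hilbert_dist C (g x) (g y) <= hilbert_dist C x y) ->
  G z -> G w -> 0 < t < 1 -> 0 < k -> cone_le C (k *: g z) w ->
  g w = w -> (1 - t) *: g z + t *: w = z -> z = w.
Proof.
move=> C_proper psi_dual Gs gs gd Gz Gw t01 k0 kw gw Fz.
have [t0 t1] := andP t01.
have [zC /= z1] := Gs _ Gz; have [wC /= w1] := Gs _ Gw.
have [gzC /= gz1] := gs _ Gz.
have Cz := interior_subset zC; have Cw := interior_subset wC.
set th := (1 - t) / (1 - t + k * t).
have den0 : 0 < 1 - t + k * t by nra.
have th0 : 0 < th by rewrite divr_gt0 //; lra.
have th1 : th < 1 by rewrite ltr_pdivrMr //; nra.
pose D := expR (hilbert_dist C z w).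
have D0 : 0 < D by exact: expR_gt0.
have dist_close E x y := @hilbert_dist_le_ln R X C C_proper psi psi_dual E x y.
have zw : cone_close C D w z.
  by apply/dist_close; rewrite ?expRK //; exact: Gs.
have gzw : cone_close C D w (g z).
  rewrite -{1}gw; apply/dist_close; rewrite ?expRK //; try exact: gs.
  exact: gd.
have := cone_close_homotopy C_proper psi_dual t01 k0 (interior_subset gzC)
  gz1 w1 kw gzw.
rewrite -/th Fz (_ : (1 - t) *: w + t *: w = w); last by module_eq w w w w.
move=> zw'; have D1 : 1 <= D.
  by case: (cone_close_bounds C_proper psi_dual Cz Cw z1 w1 zw) =>
    /(cone_ge_psi psi_dual z1 w1).
have E0 : 0 < 1 + th * (D - 1) by nra.
have := (dist_close _ z w E0 (Gs _ Gz) (Gs _ Gw)).2 zw'.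
have -> : hilbert_dist C z w = ln D by rewrite /D expRK.
rewrite ler_ln ?posrE // => DE.
have D1E : D = 1 by nra.
have [] := cone_close_bounds C_proper psi_dual Cz Cw z1 w1 zw.
by rewrite D1E !scale1r => wz zw0; exact: (cone_le_anti C_proper).
Qed.

(** * Choice of the ball and of the constants, and uniqueness of the fixed point *)

Lemma slice_ball (R : realType) (X : normedModType R) (C : set X)
    (psi : {linear X -> R^o}) (U : set X) (v : X) :
  relatively_open (slice C psi) U -> U v ->
  exists2 r : R, 0 < r & forall y, psi y = 1 -> `|y - v| < r -> U y.
Proof.
move=> [V oV ->] [[vC _] Vv].
have : nbhs v (C° `&` V).
  by apply: filterI; apply: open_nbhs_nbhs; split=> //; exact: open_interior.
move=> /nbhs_ballP[r /= r0 rP]; exists r => // y y1 yv.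
have [] : (C° `&` V) y by apply: rP; rewrite -ball_normE /= distrC.
by [].
Qed.

Theorem theorem8p1 (R : realType) (X : completeNormedModType R)
  (C : set X) (C_proper : proper_cone C) (C_int : C° !=set0)
  (psi : {linear X -> R^o}) (psi_dual : dual_cone C psi)
  (psi_neq0 : psi <> cst 0 :> (X -> R^o))
  (G : set X) (G_open : relatively_open (slice C psi) G)
  (g : X -> X) (g_maps : set_fun G (slice C psi) g)
  (g_cont : {within G, continuous g})
  (g_nonexp : forall x y, G x -> G y ->
     hilbert_dist C (g x) (g y) <= hilbert_dist C x y)
  (v : X) (Gv : G v) (g_v : g v = v)
  (dg : X -> X)
  (A1_semidiff : is_semidifferential G g v (psi @^-1` [set 0]) dg)
  (A1_maps : set_fun (psi @^-1` [set 0]) (psi @^-1` [set 0]) dg)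
  (A2 : exists (U : set X) (nu : set X -> R) (k : R),
     [/\ relatively_open (slice C psi) U, U v, U `<=` G,
         homogeneous_noncompactness_measure nu
       & set_contraction nu U g k])
  (A3 : forall x, psi x = 0 -> x = dg x -> x = 0) :
  forall w, G w -> g w = w -> w = v.
Proof.
move=> w Gw g_w.
have [U [nu [k0 [U_open Uv UG nuP gk]]]] := A2.
have [l l01 gU] := set_contractionP gk.
have Gs : G `<=` slice C psi by case: G_open => V _ -> x; case.
have [vC /= v1] := Gs _ Gv; have [wC /= w1] := Gs _ Gw.
have [r0 r00 Ur] := slice_ball U_open Uv.
set K := psi @^-1` [set 0].
have Kc : closed K.
  by apply: preimage_closed; [move=> x _; case: psi_dual => + _; exact|exact: closed_eq].
have Kt t x : 0 < t -> K x -> K (t *: x).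
  by move=> _ Kx; rewrite /K /= linearZ /= Kx scaler0.
have KU : \forall x \near (0 : X), K x -> U (v + x).
  apply/nbhs_ballP; exists r0 => // x; rewrite -ball_normE /= sub0r normrN => xr Kx.
  by apply: Ur; rewrite ?linearD ?v1 ?Kx ?addr0 // [v + x]addrC addrK.
have [c c0] := semidifferential_displacement nuP l01 gU Kc Kt KU g_v A1_semidiff A3.
move=> /nbhs_ballP[r1 /= r10 disp].
have [r [rr0 rr1 rpos]] : exists r : R, [/\ r < r0, r < r1 & 0 < r].
  exists (Num.min r0 r1 / 2).
  have : 0 < Num.min r0 r1 by rewrite lt_min r00.
  have : Num.min r0 r1 <= r0 by rewrite ge_min lexx.
  have : Num.min r0 r1 <= r1 by rewrite ge_min lexx orbT.
  by move=> *; split; lra.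
set B := [set y | psi y = 1 /\ `|y - v| <= r].
have BU : B `<=` U by move=> y [y1 yr]; apply: Ur => //; exact: le_lt_trans yr rr0.
have BG : B `<=` G by move=> y /BU /UG.
have Bv : B v by split=> //; rewrite subrr normr0 ltW.
have displacement y : B y -> c * `|y - v| <= `|g y - y|.
  move=> [y1 yr]; have := disp (y - v).
  rewrite -ball_normE /= sub0r normrN (le_lt_trans yr rr1) => /(_ isT).
  by rewrite [v + (y - v)]addrC subrK; apply; rewrite /K /= linearB /= y1 v1 subrr.
have bB : bounded_set B.
  apply/bounded_setP; exists (r + `|v|) => y [_ yr].
  by rewrite -[y](subrK v) (le_trans (ler_normD _ _)) // lerD2r.
have gB A : A `<=` B -> bounded_set A ->
    bounded_set (g @` A) /\ nu (g @` A) <= l * nu A.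
  by move=> AB; apply: gU => y /AB /BU.
have [Mg gM] : exists Mg : R, forall y, B y -> `|g y| <= Mg.
  have [/bounded_setP[M MP] _] := gB B (fun _ => id) bB.
  by exists M => y By; apply: MP; exists y.
have Mg0 : 0 <= Mg by apply: le_trans (gM v Bv).
(* [g] is bounded on [B] and [v], [w] are interior points, so one [k] serves for all of [B]; this
   makes the contraction factor uniform. *)
have [k kpos kP] : exists2 k : R, 0 < k & forall y, B y ->
    cone_le C (k *: g y) v /\ cone_le C (k *: g y) w.
  have [ev ev0 evP] := interior_absorbs vC.
  have [ew ew0 ewP] := interior_absorbs wC.
  exists (Num.min ev ew / (Mg + 1)).
    by rewrite divr_gt0 ?lt_min ?ev0 //; lra.
  have m0 : 0 < Num.min ev ew by rewrite lt_min ev0.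
  move=> y By; have ge : `|Num.min ev ew / (Mg + 1) *: g y| <= Num.min ev ew.
    rewrite normrZ gtr0_norm ?divr_gt0 //; last lra.
    rewrite mulrAC ler_pdivrMr; last lra.
    by rewrite ler_pM2l //; have := gM _ By; lra.
  by split; [apply: evP|apply: ewP]; apply: le_trans ge _; rewrite ge_min lexx ?orbT.
have Cv := interior_subset vC; have Cw := interior_subset wC.
have [L L0 [wv ww vv vw]] : exists2 L : R, 0 <= L &
    [/\ cone_le C (w - v) (L *: v), cone_le C (w - v) (L *: w),
        cone_le C (v - w) (L *: v) & cone_le C (v - w) (L *: w)].
  have [a a0 aP] := interior_absorbs_point C_proper (w - v) vC.
  have [b b0 bP] := interior_absorbs_point C_proper (w - v) wC.
  have [a' a0' aP'] := interior_absorbs_point C_proper (v - w) vC.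
  have [b' b0' bP'] := interior_absorbs_point C_proper (v - w) wC.
  exists (a + b + a' + b'); first lra.
  split; [apply: cone_le_trans aP _|apply: cone_le_trans bP _|
          apply: cone_le_trans aP' _|apply: cone_le_trans bP' _] => //;
    apply: cone_le_scalel => //; lra.
(* [T] bounds [|g y - (v + s *: (w - v))|] for [y] in [B] and [s] in [0, 1]; [t] is chosen so that
   [t < 1] and [t * T < c * r]. *)
pose T := `|v| + `|w - v| + Mg.
have T0 : 0 <= T by rewrite !addr_ge0.
have cr0 : 0 < c * r by rewrite mulr_gt0.
pose t := c * r / (T + 1 + c * r).
have den0 : 0 < T + 1 + c * r by lra.
have tE : t * (T + 1 + c * r) = c * r by rewrite /t divfK // gt_eqF.
have tpos : 0 < t by rewrite divr_gt0.
have t01 : 0 < t < 1 by rewrite tpos ltr_pdivrMr //; lra.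
have tT : t * T < c * r by nra.
have Bg y : B y -> [/\ C (g y), psi y = 1, psi (g y) = 1,
    cone_le C (k *: g y) v & cone_le C (k *: g y) w].
  move=> By; have [gyC /= gy1] := g_maps _ (BG _ By); have [kv kw] := kP _ By.
  by split=> //; [exact: interior_subset|case: By].
have dist_close D x y := @hilbert_dist_le_ln R X C C_proper psi psi_dual D x y.
have gD D x y : B x -> B y -> cone_close C D y x -> cone_close C D (g y) (g x).
  move=> /BG Gx /BG Gy yx.
  have [xC /= x1] := Gs _ Gx; have [yC /= y1] := Gs _ Gy.
  have D0 : 0 < D.
    have [/(cone_ge_psi psi_dual x1 y1) D1 _] := cone_close_bounds C_proper
      psi_dual (interior_subset xC) (interior_subset yC) x1 y1 yx.
    exact: lt_le_trans D1.
  apply/(dist_close _ _ _ D0 (g_maps _ Gx) (g_maps _ Gy)).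
  apply: le_trans (g_nonexp _ _ Gx Gy) _.
  exact/(dist_close _ _ _ D0 (Gs _ Gx) (Gs _ Gy)).
set F := homotopy g v w t.
have cA := @compact_closure_reachable R X nu l t B g v w nuP l01 t01 gB bB Bv g_v.
have gcB : {within B, continuous g} by exact: continuous_subspaceW BG g_cont.
have CF s y : 0 <= s <= 1 -> B y -> C (F s y).
  move=> s01 By; have [Cgy _ _ kv kw] := Bg _ By.
  have kp := cone_le_segment C_proper s01 kv kw.
  have Cp : C (v + s *: (w - v)).
    rewrite -[v + _](subrK (k *: g y)); apply: (cone_add C_proper kp).
    by apply: (cone_scale C_proper) => //; exact: ltW.
  have [t0 t1] := andP t01.
  by apply: (cone_add C_proper); apply: (cone_scale C_proper) => //; lra.
have harm (n : nat) : 0 < (harmonic n : R) <= 1.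
  by rewrite harmonic_gt0 /= /harmonic /= invf_le1 // ler1n.
have h (n : nat) := homotopy_tracking C_proper psi_dual t01 kpos L0 (harm n)
  v1 w1 Bg gD wv ww vv vw Bv g_v.
have BC y : B y -> C y /\ C (g y) /\ psi (g y) = 1.
  by move=> By; case: (Bg _ By) (Gs _ (BG _ By)) => ? _ ? _ _ [/interior_subset].
have [z [s [Bz s01 Fz sz]]] :=
  homotopy_limit C_proper psi_dual w1 Bv BC CF gcB cA h.
(* On the sphere, [c * r <= |g z - z| <= t * T] would contradict the choice of [t]. *)
have zr : `|z - v| < r.
  rewrite ltNge; apply/negP => rz.
  have gz : g z - z = t *: (g z - (v + s *: (w - v))).
    rewrite -{2}Fz /homotopy.
    by module_eq (g z) v w w.
  have := displacement z Bz; rewrite gz normrZ gtr0_norm //.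
  have : `|g z - (v + s *: (w - v))| <= T.
    rewrite (le_trans (ler_normB _ _)) // addrC /T lerD ?gM //.
    rewrite (le_trans (ler_normD _ _)) // lerD2l normrZ.
    have [s0 s1] := andP s01; rewrite ger0_norm //.
    by rewrite ler_piMl.
  nra.
have s1 : s = 1 by case: sz => // /(lt_le_trans zr); rewrite ltxx.
have zw : z = w.
  apply: (hilbert_fixed_points_eq C_proper psi_dual Gs g_maps g_nonexp
    (BG _ Bz) Gw t01 kpos (kP _ Bz).2 g_w).
  by rewrite -[RHS]Fz s1 /homotopy scale1r; module_eq (g z) v w w.
(* Now [w] lies in [B], and its displacement is 0. *)
have := displacement z Bz; rewrite zw g_w subrr normr0 pmulr_rle0 //.
by rewrite normr_le0 subr_eq0 => /eqP.
Qed.
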